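(* Let $n\geq 4$ be an integer and let $\lambda>-1/2$ be a real number. Let $x_{nn}(\lambda)$ denote the largest zero of the Gegenbauer (ultraspherical) polynomial $P_n^{(\lambda)}$. Then $$1-x_{nn}(\lambda)<\frac{(2\lambda+1)(2\lambda+3)(2\lambda+7)}{(10\lambda+17)\big[n(n+2\lambda)+\frac{1}{8}(2\lambda+1)^2\big]}.$$
   Context: For $\lambda>-1/2$, the Gegenbauer (ultraspherical) polynomial $P_n^{(\lambda)}$ of degree $n$ is, up to a nonzero constant factor (irrelevant for its zeros), the Jacobi polynomial $P_n^{(\alpha,\alpha)}$ with $\alpha=\lambda-\frac12$, where $$P_n^{(\alpha,\beta)}(x)=\frac{(\alpha+1)_n}{n!}\sum_{k=0}^{n}\frac{(-n)_k\,(n+\alpha+\beta+1)_k}{k!\,(\alpha+1)_k}\Big(\frac{1-x}{2}\Big)^k,$$ with $(a)_0=1$ and $(a)_k=a(a+1)\cdots(a+k-1)$. Equivalently, it is the degree-$n$ orthogonal polynomial on $[-1,1]$ with respect to the weight $(1-x^2)^{\lambda-1/2}$. Its zeros are real, simple and lie in $(-1,1)$; they are denoted $x_{1n}(\lambda)<x_{2n}(\lambda)<\cdots<x_{nn}(\lambda)$. *)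

(* Defs.v *)
From HB Require Import structures.
From mathcomp Require Import all_boot all_order all_algebra.
From mathcomp Require Import reals.
From mathcomp Require Import polyrcf.

Set Implicit Arguments.
Unset Strict Implicit.
Unset Printing Implicit Defensive.

Import Order.TTheory GRing.Theory Num.Theory.
Local Open Scope ring_scope.

Definition pochhammer (R : realType) (a : R) (k : nat) : R :=
  \prod_(i < k) (a + i%:R).

Definition jacobi (R : realType) (n : nat) (alpha beta : R) : {poly R} :=
  (pochhammer (alpha + 1) n / n`!%:R) *:
  \sum_(k < n.+1)
    ((pochhammer (- n%:R) k * pochhammer (n%:R + alpha + beta + 1) k)
       / (k`!%:R * pochhammer (alpha + 1) k)) *:
    (2^-1 *: (1 - 'X)) ^+ k.

(* Not the classical normalisation, which differs by a factor independent of
   the variable and makes the polynomial vanish identically at lambda = 0. *)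
Definition gegenbauer (R : realType) (n : nat) (lambda : R) : {poly R} :=
  jacobi n (lambda - 2^-1) (lambda - 2^-1).

(* [rootsR p] lists the distinct real roots of [p] in increasing order; the
   default 0 is reached only when [p] is zero or has no real root. *)
Definition largest_zero (R : realType) (p : {poly R}) : R := last 0 (rootsR p).

Lemma largest_zeroP (R : realType) (p : {poly R}) (y : R) :
  p != 0 -> root p y -> root p (largest_zero p) /\ y <= largest_zero p.
Proof.
move=> p0 py.
have mem_rootsR x : (x \in rootsR p) = root p x.
  by rewrite -(roots_on_rootsR p0 x) in_itv.
have: y \in rootsR p by rewrite mem_rootsR.
have srt : sorted <=%R (rootsR p).
  by apply: (sub_sorted _ (sorted_roots _ _ p)) => u v /ltW.
rewrite /largest_zero -mem_rootsR.
case: (rootsR p) srt => [//|a s] srt yin; split.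
  by rewrite -[last _ _]/(last a s) mem_last.
have iy : (index y (a :: s) <= size s)%N by rewrite -ltnS [(_ < _)%N]index_mem.
rewrite -[X in X <= _](nth_index 0 yin) -nth_last.
apply: (sorted_leq_nth le_trans le_refl 0 srt) => //; by rewrite inE /= ltnS.
Qed.

(* Main.v *)
Require Import Defs.
From HB Require Import structures.
From mathcomp Require Import all_boot all_order all_algebra.
From mathcomp Require Import reals.
From mathcomp Require Import complex ring lra.

(** With a = lambda + 1/2 and y = (1 - x)/2 the Gegenbauer polynomial becomes,
    up to a constant, h(y) = 2F1(-n, n + 2a - 1; a; y).  Its n zeros y_i are
    real, because the three-term recurrence propagates the sign of
    Im (h_(n+1)(z) conj(h_n(z))) for non-real z, and positive, because the
    coefficients of h alternate in sign.  The smallest zero therefore satisfies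
    y_1 <= S_3 / S_4 where S_k is the sum of the y_i^-k, and S_3, S_4 are
    explicit in the first four coefficients of h.  With N = n(n + 2 lambda), the
    inequality S_3 / S_4 < 2a(a+1)(a+3) / ((5a+6)(N + a^2/2)) reduces to the
    positivity of a polynomial in a and N with positive coefficients. *)

Set Implicit Arguments.
Unset Strict Implicit.
Unset Printing Implicit Defensive.

Import Order.TTheory GRing.Theory Num.Theory.
Local Open Scope ring_scope.

(** * General tools: three-term recurrences off the real axis, and Newton's identities *)

Lemma three_term_recurrence_neq0 (C : numClosedFieldType) (w : C)
    (A B D : nat -> C) (p : nat -> C) :
    (forall n, 0 < A n) -> (forall n, 0 < B n) -> (forall n, 0 < D n) ->
    p 0%N = 1 -> p 1%N = w ->
    (forall n, A n * p n.+2 = B n * w * p n.+1 - D n * p n) ->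
    'Im w != 0 ->
  forall n, p n != 0.
Proof.
move=> A_gt0 B_gt0 D_gt0 p0 p1 rec w_nreal.
have Im_conjC_r (x y : C) : 'Im (x * y^*) = - 'Im (y * x^*).
  by rewrite -Im_conj rmorphM /= conjCK mulrC.
have w2_gt0 : 0 < 'Im w * 'Im w.
  by rewrite -expr2 real_exprn_even_gt0 ?Creal_Im ?w_nreal.
(* Multiply the recurrence by the conjugate of [p n.+1] and take imaginary parts: the [B] term gives
   ['Im w] times a squared modulus, and conjugating the [D] term flips its sign, so both
   contributions have the sign of ['Im w]. The factor ['Im w] treats the two half-planes at once. *)
have pos n : 0 < 'Im w * 'Im (p n.+1 * (p n)^*).
  elim: n => [|n IHn]; first by rewrite p0 p1 conjC1 mulr1.
  have pn_neq0 : p n.+1 != 0.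
    by apply/eqP=> pn0; move: IHn; rewrite pn0 mul0r raddf0 mulr0 ltxx.
  rewrite -(pmulr_rgt0 _ (A_gt0 n)) mulrCA -ImMl ?gtr0_real //.
  rewrite mulrA rec mulrBl raddfB /= -!mulrA ImMl ?gtr0_real //.
  rewrite ImMr ?ger0_real ?mul_conjC_ge0 // ImMl ?gtr0_real //.
  rewrite (Im_conjC_r (p n)) mulrN opprK mulrDr addr_gt0 //.
    by rewrite mulrCA mulr_gt0 // mulrA pmulr_lgt0 // mul_conjC_gt0.
  by rewrite mulrCA mulr_gt0.
case=> [|n]; first by rewrite p0 oner_eq0.
by apply/eqP=> pn0; move: (pos n); rewrite pn0 mul0r raddf0 mulr0 ltxx.
Qed.

(** Newton's identities, with [P]_k[equal to (-1)^k times the k-th elementary symmetric function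
    of]u[. The induction adds one factor at a time;]P[_0 = 1] is carried along because the new
    coefficient of degree 1 involves it. *)
Lemma power_sums_of_coef (F : comNzRingType) (u : seq F)
    (P := \prod_(x <- u) (1 - x *: 'X)) :
  [/\ P`_0 = 1,
      \sum_(x <- u) x ^+ 3 = - P`_1 ^+ 3 + 3 * P`_1 * P`_2 - 3 * P`_3 &
      \sum_(x <- u) x ^+ 4 = P`_1 ^+ 4 - 4 * P`_1 ^+ 2 * P`_2
        + 2 * P`_2 ^+ 2 + 4 * P`_1 * P`_3 - 4 * P`_4].
Proof.
rewrite {}/P; elim: u => [|x u [P0 S3 S4]].
  by rewrite !big_nil !coef1 /=; split=> //; ring.
rewrite !big_cons S3 S4; set Q := \prod_(j <- u) _ in P0 *.
have coefS k : ((1 - x *: 'X) * Q)`_k.+1 = Q`_k.+1 - x * Q`_k.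
  by rewrite mulrBl mul1r -scalerAl coefB coefZ coefXM.
have coef0 : ((1 - x *: 'X) * Q)`_0 = Q`_0.
  by rewrite mulrBl mul1r -scalerAl coefB coefZ coefXM /= mulr0 subr0.
by rewrite !coefS coef0 P0; split=> //; ring.
Qed.

(** * Pochhammer symbols and the coefficients of the hypergeometric polynomial *)

Section Hypergeometric.
Variable R : realType.
Implicit Types (a x : R) (n k : nat).

Lemma pochhammer0 x : pochhammer x 0 = 1.
Proof. by rewrite /pochhammer big_ord0. Qed.

Lemma pochhammerSr x k : pochhammer x k.+1 = pochhammer x k * (x + k%:R).
Proof. by rewrite /pochhammer big_ord_recr. Qed.

Lemma pochhammerSl x k : pochhammer x k.+1 = x * pochhammer (x + 1) k.
Proof.
rewrite /pochhammer big_ord_recl addr0; congr (_ * _).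
by apply: eq_bigr => i _; rewrite -addrA -natr1 [1 + _]addrC.
Qed.

Lemma pochhammer_gt0 x k : 0 < x -> 0 < pochhammer x k.
Proof. by move=> x_gt0; apply: prodr_gt0 => i _; rewrite ltr_wpDr. Qed.

Lemma pochhammer_opp_nat n k : (n < k)%N -> pochhammer (- n%:R : R) k = 0.
Proof.
by move=> lt_nk; rewrite /pochhammer (bigD1 (Ordinal lt_nk)) //= addNr mul0r.
Qed.

(* hpoly a n is 2F1(-n, n + 2a - 1; a; 'X). *)
Definition hcoef a n k : R :=
  pochhammer (- n%:R) k * pochhammer (n%:R + 2 * a - 1) k
    / (k`!%:R * pochhammer a k).

Definition hpoly a n : {poly R} := \poly_(k < n.+1) hcoef a n k.

(** Holds for every [k], since (-n)_k vanishes beyond n; coefficient identities then need no case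
    distinction on the degree. *)
Lemma coef_hpoly a n k : (hpoly a n)`_k = hcoef a n k.
Proof.
rewrite coef_poly ltnS; case: leqP => // lt_nk.
by rewrite /hcoef pochhammer_opp_nat // !mul0r.
Qed.

Lemma gegenbauerE n (lambda : R) :
  gegenbauer n lambda =
    (pochhammer (lambda + 2^-1) n / n`!%:R) *:
      (hpoly (lambda + 2^-1) n \Po (2^-1 *: (1 - 'X))).
Proof.
rewrite /gegenbauer /jacobi /hpoly poly_def.
have -> : lambda - 2^-1 + 1 = lambda + 2^-1 by field.
congr (_ *: _); rewrite raddf_sum /=; apply: eq_bigr => k _.
rewrite comp_polyZ comp_Xn_poly /hcoef.
by congr (_ * pochhammer _ _ / _ *: _); field.
Qed.

Lemma hcoef0 a n : hcoef a n 0 = 1.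
Proof. by rewrite /hcoef !pochhammer0 !mulr1 divr1. Qed.

Lemma hcoefS a n k : 0 < a ->
  hcoef a n k.+1 =
  - (n%:R - k%:R) * (n%:R + 2 * a - 1 + k%:R) / (k.+1%:R * (a + k%:R))
    * hcoef a n k.
Proof.
move=> a_gt0; rewrite /hcoef !pochhammerSr factS natrM.
have := pochhammer_gt0 k a_gt0; set pa := pochhammer a k => pa_gt0.
have : 0 < k`!%:R :> R by rewrite ltr0n fact_gt0.
set f := k`!%:R => f_gt0; have := ltr0Sn R k; have := ler0n R k.
rewrite -natr1; set K := k%:R => K_ge0 K1_gt0.
by field; rewrite !gt_eqF // ltr_wpDr.
Qed.

(** The Gegenbauer recurrence in x = 1 - 2y, normalised to the value 1 at x = 1, read off at
    y^(k+1). All Pochhammer symbols are reduced to [u] and [v], which leaves a rational identity. *)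
Lemma hcoef_recurrence a n k : 0 < a ->
  (n.+1%:R + 2 * a - 1) * hcoef a n.+2 k.+1 =
  (2 * n.+1%:R + 2 * a - 1) * (hcoef a n.+1 k.+1 - 2 * hcoef a n.+1 k)
    - n.+1%:R * hcoef a n k.+1.
Proof.
move=> a_gt0; rewrite /hcoef.
set u := pochhammer (- n.+1%:R) k; set v := pochhammer (n.+1%:R + 2 * a - 1) k.
have -> : pochhammer (- n.+2%:R) k.+1 = - n.+2%:R * u.
  by rewrite pochhammerSl; congr (_ * pochhammer _ _); ring.
have -> : pochhammer (- n.+1%:R) k.+1 = u * (- n.+1%:R + k%:R).
  by rewrite pochhammerSr.
have -> : pochhammer (n.+1%:R + 2 * a - 1) k.+1
    = v * (n.+1%:R + 2 * a - 1 + k%:R) by rewrite pochhammerSr.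
have -> : pochhammer (n%:R + 2 * a - 1) k.+1 = (n%:R + 2 * a - 1) * v.
  by rewrite pochhammerSl; congr (_ * pochhammer _ _); ring.
(* The symbols for n and n + 2 are not polynomial multiples of [u] and [v]; in [up] and [down] one
   extra factor completes each to a symbol of length k + 2 with the same starting point as [u] or
   [v]. *)
have up : n.+1%:R * pochhammer (- n%:R) k.+1
    = - (u * (- n.+1%:R + k%:R) * (- n.+1%:R + k.+1%:R)).
  rewrite -!pochhammerSr [pochhammer (- n.+1%:R) _]pochhammerSl mulNr opprK.
  by congr (_ * pochhammer _ _); ring.
have down : (n.+1%:R + 2 * a - 1) * pochhammer (n.+2%:R + 2 * a - 1) k.+1
    = v * (n.+1%:R + 2 * a - 1 + k%:R) * (n.+1%:R + 2 * a - 1 + k.+1%:R).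
  rewrite -!pochhammerSr [pochhammer (n.+1%:R + _ - _) _]pochhammerSl.
  by congr (_ * pochhammer _ _); ring.
have n1_gt0 : 0 < n.+1%:R + 2 * a - 1.
  by rewrite -natr1 addrAC addrK ltr_wpDl // mulr_gt0.
have -> : pochhammer (- n%:R) k.+1
    = - (u * (- n.+1%:R + k%:R) * (- n.+1%:R + k.+1%:R)) / n.+1%:R.
  by rewrite -up [n.+1%:R * _]mulrC mulfK // pnatr_eq0.
have -> : pochhammer (n.+2%:R + 2 * a - 1) k.+1
    = v * (n.+1%:R + 2 * a - 1 + k%:R) * (n.+1%:R + 2 * a - 1 + k.+1%:R)
        / (n.+1%:R + 2 * a - 1).
  by rewrite -down [(_ - 1) * _]mulrC mulfK // gt_eqF.
rewrite pochhammerSr factS natrM.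
have := pochhammer_gt0 k a_gt0; set pa := pochhammer a k => pa_gt0.
have : 0 < k`!%:R :> R by rewrite ltr0n fact_gt0.
set f := k`!%:R => f_gt0; have := ltr0Sn R k; have := ler0n R k.
have := ltr0Sn R n; move: n1_gt0; rewrite -natr1 -[n.+2%:R]natr1 -natr1.
rewrite -[k.+1%:R]natr1; set K := k%:R; set N := n%:R.
move=> n1_gt0 N1_gt0 K_ge0 K1_gt0.
by field; rewrite !gt_eqF // ltr_wpDr.
Qed.

(** * Three-term recurrence; the roots are real and positive *)

Lemma hpoly0 a : hpoly a 0 = 1.
Proof. by rewrite /hpoly poly_def big_ord1 hcoef0 scale1r. Qed.

Lemma hpoly1 a : 0 < a -> hpoly a 1 = 1 - 2 *: 'X.
Proof.
move=> a_gt0; rewrite /hpoly poly_def big_ord_recl big_ord1 /= /bump /= addn0.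
rewrite hcoefS // hcoef0 scale1r -scaleNr.
by congr (_ + _ *: _); field; rewrite gt_eqF.
Qed.

Lemma hpoly_recurrence a n : 0 < a ->
  (n.+1%:R + 2 * a - 1) *: hpoly a n.+2 =
  (2 * n.+1%:R + 2 * a - 1) *: ((1 - 2 *: 'X) * hpoly a n.+1)
    - n.+1%:R *: hpoly a n.
Proof.
move=> a_gt0; apply/polyP => -[|k].
  rewrite mulrBl mul1r -scalerAl !(coefB, coefZ) coefXM !coef_hpoly /=.
  by rewrite !hcoef0; ring.
rewrite mulrBl mul1r -scalerAl !(coefB, coefZ) coefXM !coef_hpoly /=.
exact: hcoef_recurrence.
Qed.

Lemma hpoly_root_real (C : numClosedFieldType) (f : {rmorphism R -> C})
    a n (z : C) :
    (forall x, 0 < x -> 0 < f x) -> 0 < a ->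
  root (map_poly f (hpoly a n)) z -> z \is Num.real.
Proof.
move=> f_gt0 a_gt0 z_root; apply: contraT => z_nreal.
have w_nreal : 'Im (1 - 2 * z) != 0.
  have -> : 'Im (1 - 2 * z) = - (2 * 'Im z).
    rewrite raddfB /= ImMl ?realn // -[RHS]add0r; congr (_ - _).
    by apply/Creal_ImP/real1.
  rewrite oppr_eq0 mulf_neq0 ?pnatr_eq0 //.
  by apply: contra z_nreal => /eqP/Creal_ImP.
pose A m := f (m.+1%:R + 2 * a - 1); pose B m := f (2 * m.+1%:R + 2 * a - 1).
pose D m : C := f m.+1%:R; pose p m := (map_poly f (hpoly a m)).[z].
have A_gt0 m : 0 < A m.
  by apply: f_gt0; rewrite -natr1; have := ler0n R m; lra.
have B_gt0 m : 0 < B m.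
  by apply: f_gt0; rewrite -natr1; have := ler0n R m; lra.
have D_gt0 m : 0 < D m by apply: f_gt0; rewrite ltr0n.
have mapE : map_poly f (1 - 2 *: 'X) = 1 - 2 *: 'X.
  by rewrite rmorphB rmorph1 /= map_polyZ map_polyX rmorph_nat.
have p0 : p 0%N = 1 by rewrite /p hpoly0 rmorph1 hornerC.
have p1 : p 1%N = 1 - 2 * z by rewrite /p hpoly1 // mapE !hornerE.
have rec m : A m * p m.+2 = B m * (1 - 2 * z) * p m.+1 - D m * p m.
  have := congr1 (fun q => (map_poly f q).[z]) (hpoly_recurrence m a_gt0).
  rewrite [map_poly f (_ - _)]rmorphB /= !map_polyZ [map_poly f (_ * _)]rmorphM.
  by rewrite /= mapE !hornerE.
have := three_term_recurrence_neq0 A_gt0 B_gt0 D_gt0 p0 p1 rec w_nreal n.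
by rewrite [p n](rootP z_root) eqxx.
Qed.

Lemma hpoly_root_gt0 a n x : (0 < n)%N -> 0 < a ->
  root (hpoly a n) x -> 0 < x.
Proof.
move=> n_gt0 a_gt0; apply: contraTT; rewrite -leNgt => x_le0.
(* For x <= 0 the ratio of consecutive terms is nonnegative, so the value at x is at least the
   constant term 1. *)
have term_ge0 k : (k <= n)%N -> 0 <= hcoef a n k * x ^+ k.
  elim: k => [_|k IHk lt_kn]; first by rewrite hcoef0 mulr1.
  have -> : hcoef a n k.+1 * x ^+ k.+1 =
      (n%:R - k%:R) * (n%:R + 2 * a - 1 + k%:R) / (k.+1%:R * (a + k%:R))
        * - x * (hcoef a n k * x ^+ k).
    by rewrite hcoefS // exprS; ring.
  rewrite mulr_ge0 ?IHk 1?ltnW // mulr_ge0 ?oppr_ge0 //.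
  have n_ge1 : 1 <= n%:R :> R by rewrite ler1n.
  have k_ge0 := ler0n R k.
  rewrite divr_ge0 // mulr_ge0 //; try lra.
  by rewrite subr_ge0 ler_nat ltnW.
rewrite rootE /hpoly horner_poly big_ord_recl /= hcoef0 mulr1.
rewrite gt_eqF // ltr_wpDr // sumr_ge0 // => i _.
by rewrite term_ge0 // lift0 ltn_ord.
Qed.

(** * The inequality between S_3 and S_4, written in the coefficients *)

Lemma hcoef_ineq a n (h := hcoef a n) :
    (0 < n)%N -> 0 < a ->
  - h 1%N ^+ 3 + 3 * h 1%N * h 2 - 3 * h 3 <
  2 * a * (a + 1) * (a + 3)
    / ((5 * a + 6) * (n%:R * (n%:R + 2 * a - 1) + a ^+ 2 / 2)) *
  (h 1%N ^+ 4 - 4 * h 1%N ^+ 2 * h 2 + 2 * h 2 ^+ 2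
     + 4 * h 1%N * h 3 - 4 * h 4).
Proof.
move=> n_gt0 a_gt0.
have n_ge1 : 1 <= n%:R :> R by rewrite ler1n.
set N : R := n%:R * (n%:R + 2 * a - 1).
have N_gt0 : 0 < N by rewrite mulr_gt0 //; lra.
(* Since (n - k)(n + 2a - 1 + k) = N - k(2a - 1 + k), the degree enters the coefficients only
   through [N]. *)
have h1 : h 1%N = - N / a.
  by rewrite /h hcoefS // hcoef0 /N; field; rewrite gt_eqF.
have h2 : h 2 = N * (N - 2 * a) / (2 * a * (a + 1)).
  rewrite /h hcoefS // -/(h 1%N) h1 /N; field.
  by rewrite !gt_eqF //; lra.
have h3 : h 3 = - N * (N - 2 * a) * (N - 2 * (2 * a + 1))
                  / (6 * a * (a + 1) * (a + 2)).
  rewrite /h hcoefS // -/(h 2) h2 /N; field.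
  by rewrite !gt_eqF //; lra.
have h4 : h 4 = N * (N - 2 * a) * (N - 2 * (2 * a + 1)) * (N - 3 * (2 * a + 2))
                  / (24 * a * (a + 1) * (a + 2) * (a + 3)).
  rewrite /h hcoefS // -/(h 3) h3 /N; field.
  by rewrite !gt_eqF //; lra.
rewrite [ltRHS]mulrAC ltr_pdivlMr; last first.
  by rewrite mulr_gt0 // ?addr_gt0 // ?divr_gt0 ?mulr_gt0 ?exprn_gt0.
rewrite -subr_gt0 h1 h2 h3 h4.
set X := (X in 0 < X).
(* The terms in N^4 cancel, because 2a(a+1)(a+3)/(5a+6) is the limit of N S_3 / S_4 as N grows with
   a fixed. Every remaining coefficient is positive. *)
have -> : X =
    N * ((8 * a ^+ 4 + 26 * a ^+ 5 + 23 * a ^+ 6 + 6 * a ^+ 7)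
         + N * (7 * a ^+ 4 + 7 / 2 * a ^+ 5)
         + N ^+ 2 * (4 * a ^+ 2 + 2 * a ^+ 3))
      / (a ^+ 3 * (a + 1) * (a + 2)).
  rewrite /X; field.
  by rewrite !gt_eqF //; lra.
by do ?[exact: a_gt0 | exact: N_gt0 | exact: ltr01 | exact: ltr0Sn
       | apply: exprn_gt0 | rewrite invr_gt0 | apply: mulr_gt0
       | apply: addr_gt0].
Qed.

(** * From reciprocal power sums to a small root *)

Lemma map_hpoly_factor (C : closedFieldType) (f : {rmorphism R -> C}) a n :
  {u : seq C | map_poly f (hpoly a n) = \prod_(z <- u) (1 - z *: 'X)
    & forall z : C, z \in u -> root (map_poly f (hpoly a n)) z^-1}.
Proof.
set p := map_poly f (hpoly a n).
have p0 : p.[0] = 1.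
  by rewrite horner_coef0 coef_map coef_hpoly hcoef0 /= rmorph1.
have p_neq0 : p != 0.
  by apply/eqP => pE; move/eqP: p0; rewrite pE horner0 eq_sym oner_eq0.
have [r] := closed_field_poly_normal p.
have : lead_coef p != 0 by rewrite lead_coef_eq0.
move: (lead_coef p) => c c_neq0 rE.
have r_root z : root p z = (z \in r).
  by rewrite rE rootZ // root_prod_XsubC.
have r_neq0 z : z \in r -> z != 0.
  by rewrite -r_root; apply: contraTneq => ->; rewrite rootE p0 oner_eq0.
(* No root is zero, so X - z = -z (1 - X/z). The scalar collected in front is then 1, by evaluation
   at 0. *)
have prodE : c *: \prod_(z <- r) ('X - z%:P) =
    (c * \prod_(z <- r) - z) *: \prod_(z <- r) (1 - z^-1 *: 'X).
  rewrite -scalerA; congr (_ *: _); rewrite -scaler_prod.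
  rewrite !big_seq; apply: eq_bigr => z /r_neq0 z_neq0.
  rewrite scalerBr scalerA mulNr mulfV // scaleN1r opprK.
  by rewrite -alg_polyC scaleNr addrC.
exists [seq z^-1 | z <- r].
  have prod0 : (\prod_(z <- r) (1 - z^-1 *: 'X)).[0] = 1.
    by rewrite horner_prod big1 // => z _; rewrite !hornerE ?mulr0 subr0.
  rewrite big_map rE prodE; move: p0; rewrite rE prodE hornerZ prod0 mulr1.
  by move=> ->; rewrite scale1r.
by move=> _ /mapP[z zr ->]; rewrite invrK r_root.
Qed.

(** The hypothesis says S_3 < b S_4. If every reciprocal root x satisfied x <= 1/b, then b x^4 <=
    x^3 for each, and summing would give b S_4 <= S_3. *)
Lemma hpoly_small_root a n (b : R) : (0 < n)%N -> 0 < a -> 0 < b ->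
    let h := hcoef a n in
    - h 1%N ^+ 3 + 3 * h 1%N * h 2 - 3 * h 3 <
      b * (h 1%N ^+ 4 - 4 * h 1%N ^+ 2 * h 2 + 2 * h 2 ^+ 2
            + 4 * h 1%N * h 3 - 4 * h 4) ->
  exists2 y, root (hpoly a n) y & y < b.
Proof.
move=> n_gt0 a_gt0 b_gt0 h ineq.
pose f : {rmorphism R -> R[i]} := real_complex R.
have f_gt0 x : 0 < x -> 0 < f x by move=> x_gt0; rewrite /f ltcR.
have [u uE u_root] := map_hpoly_factor f a n.
have real_root (x : R[i]) : x \in u ->
    exists2 y, root (hpoly a n) y & x = f y^-1 /\ 0 < y.
  move=> /u_root x_root.
  have /complex_realP[y yE] := hpoly_root_real f_gt0 a_gt0 x_root.
  rewrite yE (fmorph_root f) in x_root; exists y => //; split.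
    by rewrite fmorphV /= -[f y]yE invrK.
  exact: hpoly_root_gt0 x_root.
have [/hasP[x xu x_gt]|/hasPn u_le] :=
  boolP (has (fun x : R[i] => f b^-1 < x) u).
  have [y y_root [xE y_gt0]] := real_root x xu; exists y => //.
  by move: x_gt; rewrite xE ltcR ltf_pV2.
have [_] := power_sums_of_coef u.
rewrite -uE !coef_map !coef_hpoly /= -/h => S3 S4.
have : \sum_(x <- u) x ^+ 3 >= f b * \sum_(x <- u) x ^+ 4.
  rewrite mulr_sumr !big_seq; apply: ler_sum => x xu.
  have [y y_root [xE y_gt0]] := real_root x xu.
  (* The order on [R[i]] is only partial: the negated strict inequality becomes <= once [x] is
     written as the image of a real number. *)
  have := u_le x xu; rewrite xE ltcR -leNgt => le_b.
  rewrite -!rmorphXn -rmorphM lecR exprS mulrA ler_piMl //.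
    by rewrite exprn_ge0 // invr_ge0 ltW.
  by rewrite mulrC -ler_pdivlMr // div1r.
rewrite S3 S4 => /le_gtF/negbT/negP[]; move: ineq; rewrite -ltcR.
by rewrite !(rmorphD, rmorphB, rmorphN, rmorphM, rmorphXn, rmorph_nat).
Qed.

End Hypergeometric.

(** * Return to the Gegenbauer polynomial *)

Theorem theorem3 (R : realType) (n : nat) (lambda : R) :
  (4 <= n)%N ->
  - 2^-1 < lambda ->
  1 - largest_zero (gegenbauer n lambda) <
    ((2 * lambda + 1) * (2 * lambda + 3) * (2 * lambda + 7)) /
    ((10 * lambda + 17) *
       (n%:R * (n%:R + 2 * lambda) + 8^-1 * (2 * lambda + 1) ^+ 2)).
Proof.
move=> n_ge4 lambda_gt; have n_gt0 : (0 < n)%N by apply: leq_trans n_ge4.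
have n_ge1 : 1 <= n%:R :> R by rewrite ler1n.
set N : R := n%:R.
(* An opaque [a], so that it stays an atom for [lra] and [field]. *)
have [a aE] : {a | a = lambda + 2^-1} by exists (lambda + 2^-1).
have a_gt0 : 0 < a by lra.
have N_gt0 : 0 < N * (N + 2 * a - 1) by rewrite mulr_gt0 /N //; lra.
pose b := 2 * a * (a + 1) * (a + 3)
    / ((5 * a + 6) * (N * (N + 2 * a - 1) + a ^+ 2 / 2)).
have b_gt0 : 0 < b.
  by rewrite /b divr_gt0 // ?mulr_gt0 // ?addr_gt0 // ?divr_gt0 ?mulr_gt0
             ?exprn_gt0.
have [y y_root y_lt] :=
  hpoly_small_root n_gt0 a_gt0 b_gt0 (hcoef_ineq n_gt0 a_gt0).
have c_gt0 : 0 < pochhammer a n / n`!%:R.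
  by rewrite divr_gt0 ?pochhammer_gt0 // ltr0n fact_gt0.
have gE := gegenbauerE n lambda; rewrite -aE in gE.
(* At x = 1, that is y = 0, the value is the positive normalising constant. *)
have g_neq0 : gegenbauer n lambda != 0.
  apply/eqP => /(congr1 (fun p => p.[1])).
  rewrite gE hornerZ horner_comp !hornerE subrr mulr0 horner_coef0 coef_hpoly.
  by rewrite hcoef0 mulr1 => /eqP; rewrite gt_eqF.
have g_root : root (gegenbauer n lambda) (1 - 2 * y).
  rewrite gE rootE hornerZ horner_comp !hornerE.
  have -> : 2^-1 * (1 - (1 - 2 * y)) = y by field.
  by rewrite (rootP y_root) mulr0.
(* Hence 1 - x_nn <= 2y < 2b, and it remains to recognise the stated bound as 2b. *)
have [_ le_y] := largest_zeroP g_neq0 g_root.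
have -> : (2 * lambda + 1) * (2 * lambda + 3) * (2 * lambda + 7) /
    ((10 * lambda + 17) * (N * (N + 2 * lambda) + 8^-1 * (2 * lambda + 1) ^+ 2))
    = 2 * b.
  have lambdaE : lambda = a - 2^-1 by rewrite aE addrK.
  have a2_gt0 : 0 < a ^+ 2 by rewrite exprn_gt0.
  rewrite /b lambdaE; field.
  by rewrite !gt_eqF //=; lra.
lra.
Qed.
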